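(* Let $B\subset\mathbb R^3$ be a contractible open set. For a smooth map $f:B\to T^4$, define the immersion (section) $\iota:B\to B\times T^4$, $x\mapsto(x,f(x))$. Let $\nabla$ be the real Fourier–Mukai transform of $f$. On $B\times(T^4)^*$, let $\varphi^*$ denote the standard $G_2$-structure written in the coordinates $(x^1,x^2,x^3,y^4,\dots,y^7)$, and let $\underline\Theta^*$ be the corresponding $4$-form. Then the following are equivalent. \begin{enumerate} \item $\iota$ is an adiabatic calibrated immersion with respect to the standard $G_2$-structure on $B\times T^4$ and the standard horizontal distribution $H$ induced by $B$ on $B\times T^4$. \item $F_\nabla\wedge*\varphi^*=0$ on $B\times(T^4)^*$, i.e. $\nabla$ satisfies the $G_2$-instanton equation. \item $F_\nabla\wedge\underline\Theta^*=0$ on $B\times(T^4)^*$. \end{enumerate}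
   Context: $T^4=\mathbb R^4/2\pi\mathbb Z^4$ with coordinates $z^4,\dots,z^7$, and $(T^4)^*=(\mathbb R^4)^*/(\mathbb Z^4)^*$ with dual coordinates $y^4,\dots,y^7$ of period 1. $B$ has coordinates $x^1,x^2,x^3$. Real Fourier–Mukai transform: choosing a lift of $f$ to $B\to\mathbb R^4$ with components $f^4,\dots,f^7$, $\nabla=d+\sqrt{-1}\sum_{a=4}^7f^a(x)\,dy^a$ on the trivial Hermitian line bundle over $B\times(T^4)^*$ (well defined up to gauge), with curvature $F_\nabla=\sqrt{-1}\sum_{i,a}\frac{\partial f^a}{\partial x^i}dx^i\wedge dy^a$. Standard $G_2$-structure on $B\times T^4$: $\varphi=dx^{123}+\sum_{i=1}^3dx^i\wedge\omega_i$, where $\omega_1=dz^{45}+dz^{67}$, $\omega_2=dz^{46}-dz^{57}$, $\omega_3=-(dz^{47}+dz^{56})$; its metric $g$ is the flat one. Set $\underline\omega=\sum_idx^i\wedge\omega_i$. On $B\times(T^4)^*$, $\varphi^*$ is given by the same formula with $dz^a$ replaced by $dy^a$, giving $2$-forms $\omega_i^*$; its metric is the flat one for which $dx^i,dy^a$ are orthonormal, $*$ is the Hodge star for the orientation $dx^{123}\wedge dy^{4567}$, and $*\varphi^*=\underline\Theta^*+dy^{4567}$ with $\underline\Theta^*=dx^{12}\wedge\omega_3^*+dx^{23}\wedge\omega_1^*+dx^{31}\wedge\omega_2^*$. Adiabatic calibrated: on $B\times T^4$, $H$ is the distribution tangent to the $B$ factor with its standard orientation, $V$ is tangent to $T^4$,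 with projections $p_H,p_V$. For an oriented $3$-plane $\pi$ such that $p_H|_\pi$ is an orientation-preserving isomorphism onto $H$, set $g^H_\pi=(p_H|_\pi)^*g$, $\mathrm{vol}^H_\pi$ its volume form on the oriented space $\pi$, and $ve(\pi)=\frac12\sum_i|p_V(v_i)|^2$ for a $g^H_\pi$-orthonormal basis $\{v_i\}$. An immersion is adiabatic calibrated if all its oriented tangent planes $\pi$ have this projection property and satisfy $\underline\omega|_\pi=ve(\pi)\,\mathrm{vol}^H_\pi$. *)

(* Defs.v *)
From HB Require Import structures.
From mathcomp Require Import all_boot all_order all_algebra.
From mathcomp Require Import complex.
From mathcomp Require Import all_classical all_reals all_analysis.

Set Implicit Arguments.
Unset Strict Implicit.
Unset Printing Implicit Defensive.
Import Order.TTheory GRing.Theory Num.Theory.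
Import numFieldNormedType.Exports.
Local Open Scope ring_scope.
Local Open Scope classical_set_scope.
Local Open Scope complex_scope.
Local Open Scope quotient_scope.

Section Torus.
Variables (R : realType) (n : nat) (c : R).

Definition lattice_eqv (z w : 'rV[R]_n) : bool :=
  `[< exists k : 'rV[int]_n, z = w + c *: map_mx intr k >].

Lemma lattice_eqv_refl : reflexive lattice_eqv.
Proof.
move=> z; apply/asboolP; exists 0; apply/rowP => i.
by rewrite !mxE mulr0 addr0.
Qed.

Lemma lattice_eqv_sym : symmetric lattice_eqv.
Proof.
suff sub z w : lattice_eqv z w -> lattice_eqv w z.
  by move=> z w; apply/idP/idP; exact: sub.
move=> /asboolP[k ->]; apply/asboolP; exists (- k); apply/rowP => i.
by rewrite !mxE rmorphN mulrN addrK.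
Qed.

Lemma lattice_eqv_trans : transitive lattice_eqv.
Proof.
move=> y x z /asboolP[k ->] /asboolP[l ->]; apply/asboolP; exists (l + k).
by apply/rowP => i; rewrite !mxE rmorphD mulrDr addrA.
Qed.

Canonical lattice_equiv :=
  EquivRel lattice_eqv lattice_eqv_refl lattice_eqv_sym lattice_eqv_trans.

(* R^n / c Z^n *)
Definition torus := {eq_quot lattice_equiv}.
HB.instance Definition _ := EqQuotient.on torus.

End Torus.

Notation T4 R := (torus 4 (pi *+ 2 : R)).
Notation T4dual R := (torus 4 (1 : R)).

Definition T4_proj (R : realType) (z : 'rV[R]_4) : T4 R := \pi z.
Definition T4dual_proj (R : realType) (y : 'rV[R]_4) : T4dual R := \pi y.

(* R^7 = R^3 x R^4 is the universal cover of R^3 x T^4; indices 0, 1, 2 of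
   'I_7 are the x-coordinates, indices 3, ..., 6 the torus coordinates. *)
Definition hpart (R : realType) m (W : 'M[R]_(m, 7)) : 'M[R]_(m, 3) :=
  lsubmx (W : 'M[R]_(m, 3 + 4)).
Definition vpart (R : realType) m (W : 'M[R]_(m, 7)) : 'M[R]_(m, 4) :=
  rsubmx (W : 'M[R]_(m, 3 + 4)).
Definition hv_row (R : realType) (x : 'rV[R]_3) (y : 'rV[R]_4) : 'rV[R]_7 :=
  row_mx x y.

Definition BT4_proj (R : realType) (p : 'rV[R]_7) : 'rV[R]_3 * T4 R :=
  (hpart p, T4_proj (vpart p)).
Definition BT4dual_proj (R : realType) (p : 'rV[R]_7) : 'rV[R]_3 * T4dual R :=
  (hpart p, T4dual_proj (vpart p)).

Definition contractible (R : realType) n (B : set 'rV[R]_n) : Prop :=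
  exists (p : 'rV[R]_n) (h : R * 'rV[R]_n -> 'rV[R]_n),
    [/\ B p,
        {within [set tx | 0 <= tx.1 <= 1 /\ B tx.2], continuous h},
        forall t x, 0 <= t <= 1 -> B x -> B (h (t, x)),
        forall x, B x -> h (0, x) = x
      & forall x, B x -> h (1, x) = p].

Section Smooth.
Variable R : realType.

Fixpoint iter_partial n (s : seq 'I_n) (h : 'rV[R]_n -> R^o) : 'rV[R]_n -> R^o :=
  if s is i :: s' then fun x => 'D_(delta_mx 0 i) (iter_partial s' h) x else h.

(* On an open set, having differentiable iterated partial derivatives of all
   orders is the same as being C^oo. *)
Definition smooth_on n m (U : set 'rV[R]_n) (g : 'rV[R]_n -> 'rV[R]_m) : Prop :=
  forall (a : 'I_m) (s : seq 'I_n) (x : 'rV[R]_n),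
    U x -> differentiable (iter_partial s (fun z => g z 0 a : R^o)) x.

Definition smooth_lift n m (Y : Type) (pr : 'rV[R]_m -> Y)
    (B : set 'rV[R]_n) (f : 'rV[R]_n -> Y) (g : 'rV[R]_n -> 'rV[R]_m) : Prop :=
  smooth_on B g /\ forall x, B x -> pr (g x) = f x.

(* The local inverses of the covering pr are the charts of Y. *)
Definition smooth_map n m (Y : Type) (pr : 'rV[R]_m -> Y)
    (B : set 'rV[R]_n) (f : 'rV[R]_n -> Y) : Prop :=
  forall x, B x -> exists (U : set 'rV[R]_n) (g : 'rV[R]_n -> 'rV[R]_m),
    [/\ open U, U x & smooth_lift pr (U `&` B) f g].

(* J is the matrix of the differential of f at x. The convention is that of
   'J: the differential is v |-> v *m J, so row i of J is the image of the i-th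
   standard basis vector. J is independent of the local lift g. *)
Definition differential_at n m (Y : Type) (pr : 'rV[R]_m -> Y)
    (f : 'rV[R]_n -> Y) (x : 'rV[R]_n) (J : 'M[R]_(n, m)) : Prop :=
  exists g : 'rV[R]_n -> 'rV[R]_m,
    [/\ \forall z \near x, f z = pr (g z), differentiable g x & J = 'J g x].

Definition immersion n m (Y : Type) (pr : 'rV[R]_m -> Y)
    (B : set 'rV[R]_n) (f : 'rV[R]_n -> Y) : Prop :=
  smooth_map pr B f /\
  forall x J, B x -> differential_at pr f x J -> row_free J.

End Smooth.

(* An element of the exterior algebra of (K^n)^* is the family of its
   coefficients on the basis e_S = e_i1 /\ ... /\ e_ik, for
   S = {i1 < ... < ik}. *)
Notation ext K n := {ffun {set 'I_n} -> K^o}.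

Section Exterior.
Variables (K : comNzRingType) (n : nat).

(* e_A /\ e_B = shuffle_sign A B * e_(A :|: B) for disjoint A and B *)
Definition shuffle_sign (A B : {set 'I_n}) : K :=
  (-1) ^+ #|[set p : 'I_n * 'I_n | [&& p.1 \in A, p.2 \in B & (p.2 < p.1)%N]]%SET|.

Definition wedge (a b : ext K n) : ext K n :=
  [ffun S : {set 'I_n} => \sum_(A : {set 'I_n} | A \subset S)
     shuffle_sign A (S :\: A) * a A * b (S :\: A)].

Definition covec (i : 'I_n) : ext K n := [ffun S => (S == [set i]%SET)%:R].

(* Hodge star for the metric and orientation in which (e_0, ..., e_(n-1)) is
   an oriented orthonormal basis: e_A /\ *e_A = e_0 /\ ... /\ e_(n-1). *)
Definition hodge (a : ext K n) : ext K n :=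
  [ffun S : {set 'I_n} => shuffle_sign (~: S) S * a (~: S)].

End Exterior.

(* The value of the degree-k part of a on the rows of W, normalised by
   (e_1 /\ ... /\ e_k)(v_1, ..., v_k) = \det (e_j (v_i)). *)
Definition ext_eval (K : comNzRingType) n k (a : ext K n.+1)
    (W : 'M[K]_(k, n.+1)) : K :=
  \sum_(S : {set 'I_n.+1} | #|S| == k)
    a S * \det (\matrix_(i < k, j < k) W i (nth ord0 (enum S) j)).

Definition ext_complex (R : realType) n (a : ext R n) : ext R[i] n :=
  [ffun S => (a S)%:C].

Section G2.
Variable K : comNzRingType.

(* dc i is dx^i for i = 1, 2, 3, and dz^i (or dy^i) for i = 4, ..., 7. *)
Definition dc (i : nat) : ext K 7 := covec K (inord i.-1).
Definition dc2 (i j : nat) : ext K 7 := wedge (dc i) (dc j).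

Definition omega1 : ext K 7 := dc2 4 5 + dc2 6 7.
Definition omega2 : ext K 7 := dc2 4 6 - dc2 5 7.
Definition omega3 : ext K 7 := - (dc2 4 7 + dc2 5 6).

Definition omega_und : ext K 7 :=
  wedge (dc 1) omega1 + wedge (dc 2) omega2 + wedge (dc 3) omega3.

Definition phi : ext K 7 := wedge (dc 1) (dc2 2 3) + omega_und.

Definition Theta_und : ext K 7 :=
  wedge (dc2 1 2) omega3 + wedge (dc2 2 3) omega1 + wedge (dc2 3 1) omega2.

End G2.

(* An oriented 3-plane in the tangent space R^7 = R^3 + R^4 of B x T^4 is
   given by an oriented basis, the rows of a row-free matrix P. *)
Section Adiabatic.
Variable R : realType.
Implicit Types P W : 'M[R]_(3, 7).

Definition horizontal_oriented P : Prop := 0 < \det (hpart P).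

Definition gramH W : 'M[R]_3 := hpart W *m (hpart W)^T.

Definition gH_orthonormal P W : Prop := (W == P)%MS /\ gramH W = 1%:M.

(* The volume form of g^H on the oriented plane P: on vectors with
   coordinates A in an oriented basis, it is \det A * sqrt (\det gram). *)
Definition volH P W : R := \det (W *m pinvmx P) * Num.sqrt (\det (gramH P)).

Definition ve P : R :=
  let v := get [set W : 'M[R]_(3, 7) | gH_orthonormal P W] in
  2^-1 * \sum_(i < 3) \sum_(a < 4) vpart v i a ^+ 2.

Definition adiabatic_calibrated_plane P : Prop :=
  [/\ row_free P, horizontal_oriented P
    & forall W, (W <= P)%MS -> ext_eval (omega_und R) W = ve P * volH P W].

Definition adiabatic_calibrated_immersion (B : set 'rV[R]_3)
    (iota : 'rV[R]_3 -> 'rV[R]_3 * T4 R) : Prop :=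
  immersion (@BT4_proj R) B iota /\
  forall x J, B x -> differential_at (@BT4_proj R) iota x J ->
    adiabatic_calibrated_plane J.

End Adiabatic.

Section Forms.
Variable R : realType.

Definition form := 'rV[R]_3 * T4dual R -> ext R[i] 7.

Definition partial_ext (j : 'I_7) (a : 'rV[R]_7 -> ext R[i] 7) (p : 'rV[R]_7) :
    ext R[i] 7 :=
  [ffun S => ('D_(delta_mx 0 j) (fun q => complex.Re (a q S) : R^o) p)
          +i* ('D_(delta_mx 0 j) (fun q => complex.Im (a q S) : R^o) p)].

(* The pullback to R^7 is periodic in y, so the choice of the representative
   of m.2 is irrelevant. *)
Definition ext_diff (a : form) : form := fun m =>
  \sum_(j < 7) wedge (covec _ j)
    (partial_ext j (a \o @BT4dual_proj R) (hv_row m.1 (repr m.2))).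

(* Curvature of the connection d + A on the trivial line bundle *)
Definition curvature (A : form) : form := fun m =>
  ext_diff A m + wedge (A m) (A m).

(* The connection form of the real Fourier-Mukai transform of the map with
   lift g; the component f^(a+4) of the lift is g x 0 a. *)
Definition fm_connection (g : 'rV[R]_3 -> 'rV[R]_4) : form := fun m =>
  \sum_(a < 4) (0 +i* g m.1 0 a) *: dc R[i] (a + 4).

End Forms.

(* Main.v *)
Require Import Defs.
From HB Require Import structures.
From mathcomp Require Import all_boot all_order all_algebra.
From mathcomp Require Import complex.
From mathcomp Require Import all_classical all_reals all_analysis.
From mathcomp Require Import ring lra zify.
Import Order.TTheory GRing.Theory Num.Theory.
Import numFieldNormedType.Exports.
Local Open Scope ring_scope.

(** Let J be the 3 x 4 Jacobian matrix of the lift of f at x, with rows J_1,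
    J_2, J_3 in R^4. Every condition of the theorem is equivalent to the
    vanishing of one vector [fueter J] of R^4. Up to the signs of its entries,
    it is I_1 J_1 + I_2 J_2 + I_3 J_3, where omega_i (u, v) is the scalar product
    of I_i u and v.

    On the gauge side, the curvature is sqrt(-1) times the sum of the
    J_ia dx^i /\ dy^a ([curvature_fm_connection]), because A /\ A = 0 for a
    connection form on a line bundle. In its product with the form Theta, the
    factor dx^i meets only the summand dx^jk /\ omega_i with {i, j, k} = {1, 2, 3},
    so the result is dx^123 /\ (a 3-form in the y), whose four coefficients are
    the entries of fueter J ([wedge_mixed2_Theta]). The other summand of the
    dual 4-form, dy^4567, is killed by every dy^a, so that conditions 2 and 3
    agree ([wedge_mixed2_hodge_phi]).

    On the calibration side, the tangent plane of the section is spanned by the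
    rows of (1 | J), and its energy is |J|^2 / 2. Since I_1 I_2 = - I_3, the cross
    terms of |fueter J|^2 are values of the omega_i on pairs of rows of J, and
    this gives 2 omega (1 | J) = |J|^2 - |fueter J|^2 ([omega_und_graph]): the
    calibration inequality with its defect. The plane is adiabatic calibrated
    exactly when the defect vanishes ([calibrated_graph]).

    The tangent plane has to be computed from an arbitrary local lift of the
    section to R^7. Two lifts differ by a continuous map to a lattice, which is
    locally constant, hence they have the same Jacobian
    ([differential_section_unique]).

    The identities between constant forms in dimension seven are finite
    computations with signs. They are carried out on lists of integers and
    transported to any coefficient ring ([intform_eq]). *)

Set Implicit Arguments.
Unset Strict Implicit.
Unset Printing Implicit Defensive.

(** * Computing with exterior forms that have integer coefficients *)

Section IntegerForms.
Variable n : nat.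
Implicit Types (s : seq nat) (l m : seq (seq nat * int)).

(** Lists of naturals stand for sets of indices, because membership in a list of
    numerals computes whereas finite sets are locked. *)
Definition nset s : {set 'I_n} := [set i : 'I_n | val i \in s]%SET.

Definition nset_eqb s (t : seq nat) := all (fun i => (i \in s) == (i \in t)) (iota 0 n).

Definition disjointb s (t : seq nat) := all (fun i => ~~ ((i \in s) && (i \in t))) (iota 0 n).

Definition compl s := [seq i <- iota 0 n | i \notin s].

Definition inversions s (t : seq nat) :=
  count (fun p => [&& p.1 \in s, p.2 \in t & (p.2 < p.1)%N])
    [seq (i, j) | i <- iota 0 n, j <- iota 0 n].

Definition signz s t (c : int) := if odd (inversions s t) then - c else c.

Definition coef u l : int :=
  foldr (fun t c => if nset_eqb t.1 u then t.2 + c else c) 0 l.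

Definition intform_eqb l m :=
  all (fun u => coef u l == coef u m) (unzip1 l ++ unzip1 m).

Definition wedgez l m : seq (seq nat * int) :=
  [seq (t.1 ++ u.1, if disjointb t.1 u.1 then signz t.1 u.1 (t.2 * u.2) else 0)
  | t <- l, u <- m].

Definition hodgez l : seq (seq nat * int) :=
  [seq (compl t.1, signz t.1 (compl t.1) t.2) | t <- l].

Definition oppz_form l : seq (seq nat * int) := [seq (t.1, - t.2) | t <- l].

(** Several terms of the list may have the same index set, in any order and with
    repetitions inside the index list; their coefficients add up. *)
Definition intform (K : comNzRingType) l : ext K n :=
  [ffun S => \sum_(t <- l | nset t.1 == S) t.2%:~R].

Lemma iota_ordP (P : pred nat) :
  reflect (forall i : 'I_n, P i) (all P (iota 0 n)).
Proof.
apply: (iffP allP) => [h i|h k]; first by apply: h; rewrite mem_iota /=.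
by rewrite mem_iota /= => kn; exact: (h (Ordinal kn)).
Qed.

Lemma nset_eqE s t : (nset s == nset t) = nset_eqb s t.
Proof.
apply/eqP/iota_ordP => [/setP h i|h]; first by apply/eqP; have := h i; rewrite !inE => ->.
by apply/setP => i; rewrite !inE; exact: (eqP (h i)).
Qed.

Lemma nset_cat s t : nset (s ++ t) = (nset s :|: nset t)%SET.
Proof. by apply/setP => i; rewrite !inE mem_cat. Qed.

Lemma nset_compl s : nset (compl s) = (~: nset s)%SET.
Proof. by apply/setP => i; rewrite !inE mem_filter mem_iota /= ltn_ord andbT. Qed.

Lemma disjointbP s t : disjointb s t = [disjoint nset s & nset t].
Proof.
rewrite -setI_eq0; apply/iota_ordP/eqP => [h|/setP h i].
  by apply/setP => i; rewrite !inE; exact: (negbTE (h i)).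
by have := h i; rewrite !inE => ->.
Qed.

Lemma inversionsE s t :
  #|[set p : 'I_n * 'I_n | [&& p.1 \in nset s, p.2 \in nset t & (p.2 < p.1)%N]]%SET|
    = inversions s t.
Proof.
rewrite cardE size_filter /inversions.
have -> : [seq (i, j) | i <- iota 0 n, j <- iota 0 n] =
    [seq (val p.1, val p.2) | p <- Finite.enum ('I_n * 'I_n : finType)%type].
  rewrite [in RHS]unlock /= /prod_enum -val_enum_ord map_allpairs allpairs_mapl allpairs_mapr.
  by [].
by rewrite count_map; apply: eq_count => p /=; rewrite !inE.
Qed.

Variable K : comNzRingType.

Lemma shuffle_sign_nset s t (c : int) :
  shuffle_sign K (nset s) (nset t) * c%:~R = (signz s t c)%:~R.
Proof.
rewrite /shuffle_sign inversionsE /signz -signr_odd.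
by case: odd; rewrite ?mulN1r ?mul1r ?rmorphN.
Qed.

Lemma intform_coef u l : intform K l (nset u) = (coef u l)%:~R.
Proof.
rewrite ffunE /coef; elim: l => [|t l IH]; first by rewrite big_nil.
by rewrite big_cons nset_eqE /=; case: ifP; rewrite // rmorphD IH.
Qed.

Lemma intform_out l (S : {set 'I_n}) :
  S \notin [seq nset t.1 | t <- l] -> intform K l S = 0.
Proof.
move=> Sl; rewrite ffunE big1_seq // => t /andP[/eqP tS tl].
by case/negP: Sl; rewrite -tS; apply: (map_f (fun t => nset t.1)).
Qed.

(** Outside the index sets that occur in l or in m both coefficients vanish, so
    finitely many integer comparisons decide the equality. *)
Lemma intform_eq l m : intform_eqb l m -> intform K l = intform K m.
Proof.
move=> /allP lm; apply/ffunP => S.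
have key t : t \in l ++ m -> nset t.1 = S -> intform K l S = intform K m S.
  move=> tlm <-; rewrite !intform_coef; congr _%:~R; apply/eqP/lm.
  by rewrite -map_cat map_f.
have [/mapP[t tl St]|Sl] := boolP (S \in [seq nset t.1 | t <- l]).
  by apply: (key t); rewrite // mem_cat tl.
have [/mapP[t tm St]|Sm] := boolP (S \in [seq nset t.1 | t <- m]).
  by apply: (key t); rewrite // mem_cat tm orbT.
by rewrite !intform_out.
Qed.

Lemma intform_cat l m : intform K (l ++ m) = intform K l + intform K m.
Proof. by apply/ffunP => S; rewrite !ffunE big_cat. Qed.

Lemma intform_opp l : intform K (oppz_form l) = - intform K l.
Proof.
apply/ffunP => S; rewrite !ffunE big_map -sumrN.
by apply: eq_bigr => t _; rewrite rmorphN.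
Qed.

Lemma intform_covec (i : 'I_n) : intform K [:: ([:: val i], 1)] = covec K i.
Proof.
apply/ffunP => S; rewrite !ffunE big_cons big_nil /= eq_sym.
have -> : nset [:: val i] = [set i]%SET.
  by apply/setP => j; rewrite !inE (inj_eq val_inj).
by case: eqP => //; rewrite addr0.
Qed.

(** For a pair of terms t and u, only the splitting of S with A = nset t.1
    contributes, and this A is a possible one exactly when the index sets are
    disjoint with union S. *)
Lemma wedge_intform l m :
  wedge (intform K l) (intform K m) = intform K (wedgez l m).
Proof.
apply/ffunP => S; rewrite !ffunE [RHS]big_mkcond /wedgez big_allpairs_dep /=.
transitivity (\sum_(A : {set 'I_n} | A \subset S) \sum_(t <- l) \sum_(u <- m)
   (if (nset t.1 == A) && (nset u.1 == (S :\: A)%SET)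
    then (signz t.1 u.1 (t.2 * u.2))%:~R else 0 : K)).
  apply: eq_bigr => A AS; rewrite !ffunE -mulrA [X in _ * X]mulr_suml mulr_sumr big_mkcond.
  apply: eq_bigr => t _; case: eqP => [<-|] /=; last by rewrite big1.
  rewrite !mulr_sumr big_mkcond; apply: eq_bigr => u _; case: eqP => // <-.
  by rewrite -rmorphM shuffle_sign_nset.
rewrite exchange_big; apply: eq_bigr => t _; rewrite exchange_big; apply: eq_bigr => u _ /=.
rewrite nset_cat disjointbP.
have [dis|ndis] := boolP [disjoint nset t.1 & nset u.1]; last first.
  rewrite big1; first by case: ifP; rewrite ?mulr0z.
  move=> A _; case: ifP => // /andP[/eqP tA /eqP uA]; case/negP: ndis.
  rewrite tA uA -setI_eq0; apply/eqP/setP => i; rewrite !inE.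
  by case: (i \in A); rewrite ?andbF.
have [<-|neS] := eqVneq.
  rewrite (bigD1 (nset t.1)) /=; last exact: finset.subsetUl.
  rewrite big1 => [|A /andP[_ neA]].
    rewrite addr0 ifT //; apply/andP; split=> //; apply/eqP/setP => i; rewrite !inE.
    have := disjoint_setI0 dis => /setP/(_ i); rewrite !inE.
    by case: (val i \in t.1) => //= ->.
  by rewrite eq_sym (negbTE neA).
rewrite big1 // => A AS; case: ifP => // /andP[/eqP tA /eqP uA].
by case/eqP: neS; rewrite tA uA -{1}(finset.setIidPr AS) finset.setID.
Qed.

Lemma hodge_intform l : hodge (intform K l) = intform K (hodgez l).
Proof.
apply/ffunP => S; rewrite !ffunE big_map mulr_sumr big_mkcond [RHS]big_mkcond.
apply: eq_bigr => t _ /=; rewrite nset_compl.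
have -> : ((~: nset t.1)%SET == S) = (nset t.1 == (~: S)%SET).
  by apply/eqP/eqP => [<-|->]; rewrite finset.setCK.
by case: eqP => // tS; rewrite -shuffle_sign_nset nset_compl tS finset.setCK.
Qed.

End IntegerForms.

(** * Exterior algebra and the four-form Theta *)

(** The constant forms of the G2-structure as integer data. The coordinates of
    [dc] are numbered from 1, the indices in the lists from 0. *)
Definition dcz (i : nat) : seq (seq nat * int) := [:: ([:: i.-1], 1)].
Definition dc2z i j := wedgez 7 (dcz i) (dcz j).
Definition omega1z := dc2z 4 5 ++ dc2z 6 7.
Definition omega2z := dc2z 4 6 ++ oppz_form (dc2z 5 7).
Definition omega3z := oppz_form (dc2z 4 7 ++ dc2z 5 6).
Definition omega_undz := wedgez 7 (dcz 1) omega1z ++ wedgez 7 (dcz 2) omega2z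
  ++ wedgez 7 (dcz 3) omega3z.
Definition phiz := wedgez 7 (dcz 1) (dc2z 2 3) ++ omega_undz.
Definition Thetaz := wedgez 7 (dc2z 1 2) omega3z ++ wedgez 7 (dc2z 2 3) omega1z
  ++ wedgez 7 (dc2z 3 1) omega2z.

Lemma big_ord3 (V : nmodType) (F : 'I_3 -> V) :
  \sum_(i < 3) F i = F 0 + F 1 + F 2%:R.
Proof.
rewrite !big_ord_recl big_ord0 addr0 addrA.
by congr (F _ + F _ + F _); apply: val_inj.
Qed.

Lemma big_ord4 (V : nmodType) (F : 'I_4 -> V) :
  \sum_(i < 4) F i = F 0 + F 1 + F 2%:R + F 3%:R.
Proof.
rewrite !big_ord_recl big_ord0 addr0 !addrA.
by congr (F _ + F _ + F _ + F _); apply: val_inj.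
Qed.

Section G2Forms.
Variable K : comNzRingType.

Lemma dc_intform i : (i.-1 < 7)%N -> dc K i = intform 7 K (dcz i).
Proof. by move=> i7; rewrite /dc -intform_covec /= inordK. Qed.

Lemma dc2_intform i j :
  (i.-1 < 7)%N -> (j.-1 < 7)%N -> dc2 K i j = intform 7 K (dc2z i j).
Proof. by move=> i7 j7; rewrite /dc2 !dc_intform // wedge_intform. Qed.

Lemma omega_und_intform : omega_und K = intform 7 K omega_undz.
Proof.
rewrite /omega_und /omega1 /omega2 /omega3 !dc2_intform // !dc_intform //.
by rewrite -!(intform_cat, intform_opp) !wedge_intform -!intform_cat -!catA.
Qed.

Lemma phi_intform : phi K = intform 7 K phiz.
Proof.
by rewrite /phi omega_und_intform dc2_intform // dc_intform // wedge_intform -intform_cat.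
Qed.

Lemma Theta_intform : Theta_und K = intform 7 K Thetaz.
Proof.
rewrite /Theta_und /omega1 /omega2 /omega3 !dc2_intform //.
by rewrite -!(intform_cat, intform_opp) !wedge_intform -!intform_cat -!catA.
Qed.

Lemma hodge_phi : hodge (phi K) = Theta_und K + wedge (dc2 K 4 5) (dc2 K 6 7).
Proof.
rewrite phi_intform hodge_intform Theta_intform !dc2_intform // wedge_intform -intform_cat.
by apply: intform_eq; vm_compute.
Qed.

Lemma wedgeDl n (a b c : ext K n) : wedge (a + b) c = wedge a c + wedge b c.
Proof.
apply/ffunP => S; rewrite !ffunE -big_split; apply: eq_bigr => A _ /=.
by rewrite !ffunE mulrDr mulrDl.
Qed.

Lemma wedgeDr n (a b c : ext K n) : wedge a (b + c) = wedge a b + wedge a c.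
Proof.
apply/ffunP => S; rewrite !ffunE -big_split; apply: eq_bigr => A _ /=.
by rewrite !ffunE mulrDr.
Qed.

Lemma wedgeZl n k (a b : ext K n) : wedge (k *: a) b = k *: wedge a b.
Proof.
apply/ffunP => S; rewrite !ffunE scaler_sumr; apply: eq_bigr => A _ /=.
by rewrite !ffunE -![_ *: _]/(_ * _); ring.
Qed.

Lemma wedgeZr n k (a b : ext K n) : wedge a (k *: b) = k *: wedge a b.
Proof.
apply/ffunP => S; rewrite !ffunE scaler_sumr; apply: eq_bigr => A _ /=.
by rewrite !ffunE -![_ *: _]/(_ * _); ring.
Qed.

Lemma wedge0l n (a : ext K n) : wedge 0 a = 0.
Proof. by rewrite -(scale0r (0 : ext K n)) wedgeZl !scale0r. Qed.

Lemma wedge0r n (a : ext K n) : wedge a 0 = 0.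
Proof. by rewrite -(scale0r (0 : ext K n)) wedgeZr !scale0r. Qed.

Lemma wedge_suml n I (r : seq I) (F : I -> ext K n) a :
  wedge (\sum_(i <- r) F i) a = \sum_(i <- r) wedge (F i) a.
Proof.
by apply: (big_morph (fun b => wedge b a)) => [b c|]; rewrite ?wedgeDl ?wedge0l.
Qed.

Lemma wedge_sumr n I (r : seq I) (F : I -> ext K n) a :
  wedge a (\sum_(i <- r) F i) = \sum_(i <- r) wedge a (F i).
Proof.
by apply: (big_morph (wedge a)) => [b c|]; rewrite ?wedgeDr ?wedge0r.
Qed.

(** Up to sign, entry b is the coefficient at the coordinate b + 4 of
    I_1 c_1 + I_2 c_2 + I_3 c_3, for the rows c_i of c and the complex structures
    I_i given by omega_i; the signs are those of the 6-form F /\ Theta. *)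
Definition fueter (c : 'M[K]_(3, 4)) : 'rV[K]_4 :=
  \row_b [tuple c 0 1 + c 1 2%:R - c 2%:R 3%:R;
                c 0 0 + c 1 3%:R + c 2%:R 2%:R;
                c 0 3%:R - c 1 0 + c 2%:R 1;
                c 0 2%:R - c 1 1 - c 2%:R 0]`_b.

Definition mixed2 (c : 'M[K]_(3, 4)) : ext K 7 :=
  \sum_(i < 3) \sum_(a < 4) c i a *: dc2 K i.+1 (a + 4).

Lemma wedge_mixed2l (c : 'M[K]_(3, 4)) (a : ext K 7) :
  wedge (mixed2 c) a =
  \sum_(i < 3) \sum_(k < 4) c i k *: wedge (dc2 K i.+1 (k + 4)) a.
Proof.
rewrite wedge_suml; apply: eq_bigr => i _; rewrite wedge_suml.
by apply: eq_bigr => k _; rewrite wedgeZl.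
Qed.

(** The basis 6-form without the covector of index i, counted from 0 *)
Definition omit (i : nat) : ext K 7 := intform 7 K [:: (compl 7 [:: i], 1)].

(** Each of the twelve products dx^i /\ dy^a /\ Theta is a single basis 6-form up
    to sign: dx^i selects the summand of Theta with omega_i, and dy^a one of the
    two terms of omega_i. *)
Lemma wedge_mixed2_Theta (c : 'M[K]_(3, 4)) :
  wedge (mixed2 c) (Theta_und K) = \sum_(b < 4) fueter c 0 b *: omit (b + 3).
Proof.
(* b is the index, counted from 0, of the covector missing in the product. *)
have table i a b e : intform_eqb 7 (wedgez 7 (dc2z i a) Thetaz) [:: (compl 7 [:: b], e)] ->
    (i.-1 < 7)%N -> (a.-1 < 7)%N -> wedge (dc2 K i a) (Theta_und K) = e%:~R *: omit b.
  move=> iab i7 a7; rewrite Theta_intform dc2_intform // wedge_intform (intform_eq K iab).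
  apply/ffunP => S; rewrite !ffunE !big_mkcond !big_cons !big_nil /=.
  by case: ifP; rewrite !addr0 ?scaler0 // -[_ *: _]/(_ * _) mulr1.
rewrite wedge_mixed2l big_ord3 !big_ord4.
rewrite (table 1 4 4 1%R)%N // (table 1 5 3 1%R)%N // (table 1 6 6 1%R)%N // (table 1 7 5 1%R)%N //.
rewrite (table 2 4 5 (-1)%R)%N // (table 2 5 6 (-1)%R)%N // (table 2 6 3 1%R)%N // (table 2 7 4 1%R)%N //.
rewrite (table 3 4 6 (-1)%R)%N // (table 3 5 5 1%R)%N // (table 3 6 4 1%R)%N // (table 3 7 3 (-1)%R)%N //.
rewrite !mxE /= !addSn !add0n.
move: (omit 3) (omit 4) (omit 5) (omit 6) => o3 o4 o5 o6.
apply/ffunP => S; rewrite !ffunE -![_ *: _]/(_ * _).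
by ring.
Qed.

Lemma scale_extE n k (a : ext K n) S : (k *: a) S = k * a S.
Proof. by rewrite ffunE. Qed.

Lemma omitE b b' : (b < 7)%N -> (b' < 7)%N ->
  omit b (nset 7 (compl 7 [:: b'])) = (b == b')%:R.
Proof.
move=> b7 b7'; rewrite /omit intform_coef /coef /= -nset_eqE !nset_compl
  (inj_eq (inv_inj (@finset.setCK _))).
have -> : (nset 7 [:: b] == nset 7 [:: b']) = (b == b').
  apply/eqP/eqP => [/setP/(_ (Ordinal b7))|->//]; rewrite !inE eqxx /=.
  by move/esym/eqP.
by case: eqP.
Qed.

Lemma wedge_mixed2_Theta_eq0 (c : 'M[K]_(3, 4)) :
  wedge (mixed2 c) (Theta_und K) = 0 <-> fueter c = 0.
Proof.
rewrite wedge_mixed2_Theta; split=> [/ffunP h|->]; last first.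
  by rewrite big1 // => b _; rewrite mxE scale0r.
apply/rowP => b; have := h (nset 7 (compl 7 [:: b + 3]%N)).
have b7 (b' : 'I_4) : (b' + 3 < 7)%N by rewrite (ltn_add2r 3 _ 4).
rewrite sum_ffunE (bigD1 b) //= big1 ?addr0 => [|b' nb]; rewrite scale_extE omitE //.
  by rewrite eqxx mulr1 => ->; rewrite !mxE ffunE.
by rewrite eqn_add2r (inj_eq val_inj) (negbTE nb) mulr0.
Qed.

(** The summand dy^4567 of the dual form already contains every dy^a. *)
Lemma wedge_mixed2_hodge_phi (c : 'M[K]_(3, 4)) :
  wedge (mixed2 c) (hodge (phi K)) = wedge (mixed2 c) (Theta_und K).
Proof.
rewrite hodge_phi wedgeDr -[RHS]addr0; congr (_ + _).
rewrite wedge_mixed2l big1 // => i _; rewrite big1 // => a _.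
have i7 : (i.+1.-1 < 7)%N by apply: leq_trans (ltn_ord i) _.
have a7 : ((a + 4).-1 < 7)%N by rewrite addn4; exact: (ltn_ord a).
rewrite !dc2_intform // !wedge_intform (@intform_eq 7 K _ [::]).
  by apply/ffunP => S; rewrite !ffunE big_nil -[_ *: _]/(_ * _) mulr0.
by case: i i7 => [] [|[|[|]]] // ?; case: a a7 => [] [|[|[|[|]]]].
Qed.
End G2Forms.

Lemma fueterZ (K : comNzRingType) k (c : 'M[K]_(3, 4)) : fueter (k *: c) = k *: fueter c.
Proof.
apply/rowP => b; rewrite [LHS]mxE [RHS]mxE [in RHS]mxE.
by case: b => [] [|[|[|[|//]]]] ? /=; rewrite !mxE; ring.
Qed.

Lemma map_fueter (K L : comNzRingType) (h : {rmorphism K -> L}) (c : 'M[K]_(3, 4)) :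
  fueter (map_mx h c) = map_mx h (fueter c).
Proof.
apply/rowP => b; rewrite [LHS]mxE [RHS]mxE [in RHS]mxE.
by case: b => [] [|[|[|[|//]]]] ? /=; rewrite !mxE !(rmorphD, rmorphN).
Qed.

(** * Evaluation of omega on the graph of a linear map *)

Section Evaluation.
Variable K : comNzRingType.

(** A form and the volume of a frame scale by the same determinant under a change
    of frame, so the calibration condition has to be tested on one frame only. *)
Lemma ext_eval_mulmx n k (a : ext K n.+1) (D : 'M[K]_k) (P : 'M[K]_(k, n.+1)) :
  ext_eval a (D *m P) = \det D * ext_eval a P.
Proof.
rewrite /ext_eval mulr_sumr; apply: eq_bigr => S _.
rewrite mulrCA -det_mulmx; congr (_ * \det _).
by apply/matrixP => i j; rewrite !mxE; apply: eq_bigr => r _; rewrite mxE.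
Qed.

Definition increasing_of n (s : seq nat) := [seq i <- iota 0 n | i \in s].

Lemma val_enum_nset n s : map val (enum (nset n s)) = increasing_of n s.
Proof.
rewrite /increasing_of -val_enum_ord filter_map; congr map.
rewrite {1}/enum_mem -enumT; apply: eq_filter => i /=.
by rewrite inE.
Qed.

Lemma ext_eval_intform n k l (W : 'M[K]_(k, n.+1)) :
  all (fun t => (increasing_of n.+1 t.1 == t.1) && (size t.1 == k)) l ->
  ext_eval (intform n.+1 K l) W =
  \sum_(t <- l) t.2%:~R *
    \det (\matrix_(i < k, j < k) W i (inord (nth 0%N t.1 j))).
Proof.
move=> /allP lk; rewrite /ext_eval.
under eq_bigr do rewrite ffunE mulr_suml big_mkcond.
rewrite exchange_big [LHS]big_seq [RHS]big_seq; apply: eq_bigr => t /lk /andP[/eqP ts tk] /=.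
have sz : #|nset n.+1 t.1| = size t.1.
  by rewrite cardE -[in RHS]ts -val_enum_nset size_map.
rewrite (bigD1 (nset n.+1 t.1)) ?sz //= eqxx big1 => [|S /andP[_ /negbTE]]; last first.
  by rewrite eq_sym => ->.
rewrite addr0; congr (_ * \det _); apply/matrixP => i j; rewrite !mxE; congr (W _ _).
apply: val_inj; rewrite /= -[in RHS]ts -val_enum_nset (nth_map ord0) ?inord_val //.
by rewrite -cardE sz (eqP tk).
Qed.

Lemma det_mx22 (A : 'M[K]_2) : \det A = A 0 0 * A 1 1 - A 0 1 * A 1 0.
Proof.
rewrite (expand_det_row _ 0) !big_ord_recl big_ord0 addr0 /cofactor !det_mx11 !mxE.
have -> : lift ord0 0 = 1 :> 'I_2 by apply: val_inj.
have -> : lift 1 0 = 0 :> 'I_2 by apply: val_inj.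
by rewrite expr0 expr1 !mul1r mulN1r mulrN.
Qed.

Lemma det_mx33 (A : 'M[K]_3) : \det A =
  A 0 0 * (A 1 1 * A 2%:R 2%:R - A 1 2%:R * A 2%:R 1)
  - A 0 1 * (A 1 0 * A 2%:R 2%:R - A 1 2%:R * A 2%:R 0)
  + A 0 2%:R * (A 1 0 * A 2%:R 1 - A 1 1 * A 2%:R 0).
Proof.
have e10 : lift 1 0 = 0 :> 'I_3 by apply: val_inj.
have e11 : lift 1 1 = 2%:R :> 'I_3 by apply: val_inj.
have e01 : lift 0 0 = 1 :> 'I_3 by apply: val_inj.
have e02 : lift 0 1 = 2%:R :> 'I_3 by apply: val_inj.
have e20 : lift 2%:R 0 = 0 :> 'I_3 by apply: val_inj.
have e21 : lift 2%:R 1 = 1 :> 'I_3 by apply: val_inj.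
rewrite (expand_det_row _ 0) big_ord3 /cofactor !det_mx22.
rewrite !mxE e10 e11 e01 e02 e20 e21 /=.
by rewrite expr0 expr1 sqrrN expr1n; ring.
Qed.

Definition graph (M : 'M[K]_(3, 4)) : 'M[K]_(3, 7) := row_mx 1%:M M.

Lemma graphE (M : 'M[K]_(3, 4)) i k : (k < 7)%N ->
  graph M i (inord k) =
    if (k < 3)%N then (val i == k)%:R else M i (inord (k - 3)).
Proof.
move=> k7; case: ifP => k3.
  have -> : inord k = lshift 4 (Ordinal k3) :> 'I_(3 + 4).
    by apply: val_inj; rewrite /= inordK.
  by rewrite [LHS](row_mxEl 1%:M M) mxE.
have k4 : (k - 3 < 4)%N by rewrite ltn_subLR // leqNgt k3.
have -> : inord k = rshift 3 (Ordinal k4) :> 'I_(3 + 4).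
  by apply: val_inj; rewrite /= inordK // subnKC // leqNgt k3.
rewrite [LHS](row_mxEr 1%:M M); congr (M _ _).
by apply: val_inj; rewrite /= inordK.
Qed.

Definition sqnorm m n (M : 'M[K]_(m, n)) := \sum_i \sum_j M i j ^+ 2.

Lemma sqnorm_tr m n (M : 'M[K]_(m, n)) : sqnorm M = \tr (M *m M^T).
Proof.
apply: eq_bigr => i _; rewrite mxE; apply: eq_bigr => j _.
by rewrite mxE expr2.
Qed.

Lemma addI3 :
  ((0 + 1)%R = 1%R :> 'I_3) * ((0 + 2)%R = 2%R :> 'I_3) *
  ((1 + 1)%R = 2%R :> 'I_3) * ((1 + 2)%R = 0%R :> 'I_3) *
  ((2 + 1)%R = 0%R :> 'I_3) * ((2 + 2)%R = 1%R :> 'I_3).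
Proof. by do !split; apply: val_inj. Qed.

(** Expansion along the column of dx^i, which is a standard basis vector. With the
    row numbers taken modulo 3, the sign is the same for the three values of i. *)
Lemma det_minor_graph (M : 'M[K]_(3, 4)) (i : 'I_3) (a b : 'I_4) :
  \det (\matrix_(r < 3, s < 3)
          graph M r (inord (nth 0%N [:: val i; a + 3; b + 3]%N s))) =
  M (i + 1) a * M (i + 2%:R) b - M (i + 1) b * M (i + 2%:R) a.
Proof.
have lt7 (c : 'I_4) : (c + 3 < 7)%N by rewrite (ltn_add2r 3 _ 4).
have gi r : graph M r (inord i) = (r == i)%:R.
  by rewrite graphE ?(ltn_ord i) // (leq_trans (ltn_ord i)).
have gc r (c : 'I_4) : graph M r (inord (c + 3)) = M r c.
  by rewrite graphE // ltnNge leq_addl addnK inord_val.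
have -> : (\matrix_(r < 3, s < 3)
    graph M r (inord (nth 0%N [:: val i; a + 3; b + 3]%N s))) =
    \matrix_(r < 3, s < 3) nth 0 [:: (r == i)%:R; M r a; M r b] s.
  apply/matrixP => r s; rewrite [LHS]mxE [RHS]mxE.
  by case: s => [] [|[|[|//]]] s3 /=; rewrite ?gi ?gc.
rewrite det_mx33 !mxE /=.
have [->|[->|->]] : i = 0 \/ i = 1 \/ i = 2%:R.
  by case: i {gi} => [] [|[|[|//]]] ?; [left|right; left|right; right]; apply: val_inj.
- by rewrite !addI3 /=; ring.
- by rewrite !addI3 /=; ring.
- by rewrite !addI3 /=; ring.
Qed.

(** The calibration inequality with its defect term: the cross terms of the four
    squares are the 2 x 2 minors that omega selects in M. *)
Lemma omega_und_graph (M : 'M[K]_(3, 4)) :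
  2%:R * ext_eval (omega_und K) (graph M) = sqnorm M - sqnorm (fueter M).
Proof.
rewrite omega_und_intform.
rewrite (@intform_eq 7 K _ [:: ([:: 0; 3; 4]%N, 1%Z); ([:: 0; 5; 6]%N, 1%Z);
           ([:: 1; 3; 5]%N, 1%Z); ([:: 1; 4; 6]%N, (-1)%Z);
           ([:: 2; 3; 6]%N, (-1)%Z); ([:: 2; 4; 5]%N, (-1)%Z)]) //.
rewrite ext_eval_intform // !big_cons big_nil.
rewrite (det_minor_graph M 0 0 1) (det_minor_graph M 0 2 3) (det_minor_graph M 1 0 2).
rewrite (det_minor_graph M 1 1 3) (det_minor_graph M 2%:R 0 3) (det_minor_graph M 2%:R 1 2) //.
rewrite /sqnorm big_ord1 big_ord3 !big_ord4 !mxE /=.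
rewrite !addI3.
by ring.
Qed.
End Evaluation.

(** * Adiabatic calibrated graphs *)

Section Calibration.
Variable R : realType.
Implicit Type M : 'M[R]_(3, 4).

Lemma hpart_graph M : hpart (graph M) = 1%:M.
Proof. exact: row_mxKl. Qed.

Lemma vpart_graph M : vpart (graph M) = M.
Proof. exact: row_mxKr. Qed.

Lemma hpart_mulmx m k (D : 'M[R]_(m, k)) (W : 'M[R]_(k, 7)) :
  hpart (D *m W) = D *m hpart W.
Proof. exact/esym/mulmx_lsub. Qed.

Lemma vpart_mulmx m k (D : 'M[R]_(m, k)) (W : 'M[R]_(k, 7)) :
  vpart (D *m W) = D *m vpart W.
Proof. exact/esym/mulmx_rsub. Qed.

Lemma graph_row_free M : row_free (graph M).
Proof.
apply/row_freeP; exists (col_mx 1%:M 0 : 'M[R]_(3 + 4, 3)).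
by rewrite [LHS](mul_row_col 1%:M M) mulmx1 mulmx0 addr0.
Qed.

Lemma sqnorm_orthogonal m n (D : 'M[R]_m) (M : 'M[R]_(m, n)) :
  D *m D^T = 1%:M -> sqnorm (D *m M) = sqnorm M.
Proof.
move=> /mulmx1C DD; rewrite !sqnorm_tr trmx_mul -mulmxA mxtrace_mulC.
by rewrite -!mulmxA DD mulmx1.
Qed.

(** The horizontal part of a frame D *m graph M is D, so the frame chosen in the
    definition of the energy has D orthogonal, and the energy is that of the
    frame graph M itself. *)
Lemma ve_graph M : ve (graph M) = 2^-1 * sqnorm M.
Proof.
rewrite /ve; case: xgetP => [W _ [/eqmxP WP gW]|none]; last first.
  case: (none (graph M)); split; first by apply/eqmxP.
  by rewrite /gramH hpart_graph trmx1 mulmx1.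
have /submxP[D WD] : (W <= graph M)%MS by rewrite WP.
congr (_ * _); rewrite -[LHS]/(sqnorm (vpart W)) WD vpart_mulmx vpart_graph.
apply: sqnorm_orthogonal; move: gW.
by rewrite /gramH WD hpart_mulmx hpart_graph mulmx1.
Qed.

Lemma volH_graph M D : volH (graph M) (D *m graph M) = \det D.
Proof.
rewrite /volH /gramH hpart_graph trmx1 mulmx1 det1 sqrtr1 mulr1.
by rewrite mulmxKp ?graph_row_free.
Qed.

Lemma sqnorm_eq0 m n (M : 'M[R]_(m, n)) : sqnorm M = 0 <-> M = 0.
Proof.
split=> [/eqP|->]; last by rewrite /sqnorm big1 // => i _; rewrite big1 // => j _; rewrite mxE expr0n.
have ge0 i : 0 <= \sum_j M i j ^+ 2 by apply: sumr_ge0 => j _; apply: sqr_ge0.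
rewrite psumr_eq0 // => /allP h; apply/matrixP => i j; rewrite mxE; apply/eqP.
have := h i (mem_index_enum _); rewrite psumr_eq0 => [/allP/(_ j (mem_index_enum _))|k _].
  by rewrite sqrf_eq0.
exact: sqr_ge0.
Qed.

Lemma calibrated_graph M :
  adiabatic_calibrated_plane (graph M) <-> fueter M = 0.
Proof.
have om := omega_und_graph M.
rewrite -sqnorm_eq0; split=> [[_ _ /(_ _ (submx_refl _))]|F0].
  have := volH_graph M 1%:M; rewrite mul1mx det1 => ->; rewrite mulr1 ve_graph => e.
  by move: om; rewrite e; lra.
split; first exact: graph_row_free.
  by rewrite /horizontal_oriented hpart_graph det1 ltr01.
move=> W /submxP[D ->]; rewrite ext_eval_mulmx volH_graph ve_graph mulrC.
by congr (_ * _); move: om; rewrite F0; lra.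
Qed.

End Calibration.

(** * Derivatives and local lifts of the section *)

Local Open Scope classical_set_scope.
Local Open Scope complex_scope.

Section Derivatives.
Variable R : realType.

Lemma differentiable_row n m (g : 'rV[R]_n -> 'rV[R]_m) x :
  (forall a, differentiable (fun z => g z 0 a : R^o) x) -> differentiable g x.
Proof.
move=> dg.
have -> : g = \sum_(a < m) (fun z => g z 0 a *: delta_mx 0 a).
  by apply/funext => z; rewrite fct_sumE -row_sum_delta.
by apply: differentiable_sum => a; apply: differentiableZl; exact: dg.
Qed.

Lemma jacobian_row n m (g : 'rV[R]_n -> 'rV[R]_m) x i :
  differentiable g x -> row i ('J g x) = 'D_(delta_mx 0 i) g x.
Proof. by move=> dg; rewrite deriveEjacobian // rowE. Qed.

Lemma jacobianE n m (g : 'rV[R]_n -> 'rV[R]_m) x i a :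
  differentiable g x ->
  'J g x i a = 'D_(delta_mx 0 i) (fun z => g z 0 a : R^o) x.
Proof.
move=> dg; transitivity (row i ('J g x) 0 a); first by rewrite [RHS]mxE.
rewrite jacobian_row // derive_mx; last exact: diff_derivable.
by rewrite mxE.
Qed.

Lemma near_eq_jacobian n m (g h : 'rV[R]_n -> 'rV[R]_m) w x :
  differentiable g x -> differentiable h x ->
  (\forall z \near x, g z = h z + w) -> 'J g x = 'J h x.
Proof.
move=> dg dh gh.
apply/row_matrixP => i.
apply: etrans (jacobian_row i dg) (etrans _ (esym (jacobian_row i dh))).
rewrite [LHS](near_eq_derive _ gh) -[fun z => h z + w]/(h + cst w).
rewrite deriveD; [|exact: diff_derivable|exact: derivable_cst].
by rewrite derive_cst addr0.
Qed.

Lemma entry_le_norm n (v : 'rV[R]_n) a : `|v 0 a| <= `|v|.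
Proof.
by rewrite [leRHS]/Num.Def.normr/= mx_normrE; exact: (le_bigmax _ _ (0, a)).
Qed.

(** Two points of the lattice c Z^m at distance less than c are equal. *)
Lemma lattice_valued_near_cst n m (c : R) (h : 'rV[R]_n -> 'rV[R]_m) x :
  0 < c -> {for x, continuous h} ->
  (\forall z \near x, exists k : 'rV[int]_m, h z = c *: map_mx intr k) ->
  \forall z \near x, h z = h x.
Proof.
move=> c0 hx lat; have [k0 hk0] := nbhs_singleton lat.
have close : \forall z \near x, `|h x - h z| < c by move/cvgrPdist_lt : hx; exact.
near=> z.
have [k hk] : exists k : 'rV[int]_m, h z = c *: map_mx intr k by near: z.
have zc : `|h x - h z| < c by near: z.
apply/rowP => a; have := le_lt_trans (entry_le_norm _ a) zc.
rewrite hk hk0 !mxE -mulrBr normrM (gtr0_norm c0) -[ltRHS]mulr1 ltr_pM2l //.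
rewrite -intrB -intr_norm (ltrz1 R) => lt1; congr (_ * _%:~R).
by apply/eqP; rewrite eq_sym -subr_eq0 -normr_le0; lia.
Unshelve. all: by end_near.
Qed.

Lemma hv_row_coord (a : 'I_7) :
  (exists b, forall (x : 'rV[R]_3) (y : 'rV[R]_4), hv_row x y 0 a = x 0 b) \/
  (exists b, forall (x : 'rV[R]_3) (y : 'rV[R]_4), hv_row x y 0 a = y 0 b).
Proof.
rewrite -[a](@splitK 3 4 a); case: (fintype.split _) => b; [left|right]; exists b => x y.
  exact: row_mxEl.
exact: row_mxEr.
Qed.

Lemma derive_coord n (x v : 'rV[R]_n) b :
  'D_v (fun z : 'rV[R]_n => z 0 b : R^o) x = v 0 b.
Proof.
have := derive_mx (@derivable_id R _ (x : 'rV[R]_n) v).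
by rewrite derive_id => /matrixP/(_ 0 b); rewrite [RHS]mxE => ->.
Qed.

Lemma differentiable_hv_row (g : 'rV[R]_3 -> 'rV[R]_4) x :
  differentiable g x -> differentiable (fun z => hv_row z (g z)) x.
Proof.
move=> dg; apply: differentiable_row => a.
have [[b ab]|[b ab]] := hv_row_coord a.
  rewrite (_ : (fun z => _) = fun z : 'rV_3 => z 0 b); last by apply/funext => z.
  exact: differentiable_coord.
rewrite (_ : (fun z => _) = (fun y : 'rV_4 => y 0 b) \o g); last by apply/funext => z.
apply: differentiable_comp => //; exact: differentiable_coord.
Qed.

Lemma jacobian_hv_row (g : 'rV[R]_3 -> 'rV[R]_4) x :
  differentiable g x -> 'J (fun z => hv_row z (g z)) x = graph ('J g x).
Proof.
move=> dg; have dh := differentiable_hv_row dg.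
apply/row_matrixP => i; rewrite [LHS](jacobian_row i dh) [RHS](row_row_mx i 1%:M ('J g x)).
rewrite row1 (jacobian_row i dg).
rewrite derive_mx; last exact: diff_derivable.
apply/rowP => a; rewrite [LHS]mxE.
rewrite -[RHS]/(hv_row (delta_mx 0 i) ('D_(delta_mx 0 i) g x) 0 a).
have [[b ab]|[b ab]] := hv_row_coord a; rewrite ab.
  rewrite (_ : (fun z => _) = fun z : 'rV_3 => z 0 b); last by apply/funext => z.
  exact: derive_coord.
rewrite (_ : (fun z => _) = fun z => g z 0 b); last by apply/funext => z.
by rewrite derive_mx ?mxE //; exact: diff_derivable.
Qed.

Lemma iter_partial_cst n (s : seq 'I_n) (r : R) :
  exists r' : R, iter_partial s (cst r : 'rV[R]_n -> R^o) = cst r'.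
Proof.
elim: s => [|i s [r' IH]] /=; first by exists r.
by exists 0; apply/funext => x; rewrite IH derive_cst.
Qed.

(** The innermost derivative of a coordinate is a constant function. *)
Lemma smooth_coord n (b : 'I_n) (s : seq 'I_n) x :
  differentiable (iter_partial s (fun z : 'rV[R]_n => z 0 b : R^o)) x.
Proof.
case/lastP: s => [|s i]; first exact: differentiable_coord.
have -> : iter_partial (rcons s i) (fun z : 'rV[R]_n => z 0 b : R^o) =
    iter_partial s (cst ((delta_mx 0 i : 'rV[R]_n) 0 b)).
  elim: s => [|j s IH] /=; last by rewrite IH.
  by apply/funext => z; rewrite derive_coord.
have [r ->] := iter_partial_cst s ((delta_mx 0 i : 'rV[R]_n) 0 b).
exact: differentiable_cst.
Qed.

Lemma smooth_hv_row (U : set 'rV[R]_3) (g : 'rV[R]_3 -> 'rV[R]_4) :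
  smooth_on U g -> smooth_on U (fun z => hv_row z (g z)).
Proof.
move=> sg a s x Ux; have [[b ab]|[b ab]] := hv_row_coord a.
  rewrite (_ : (fun z => _) = fun z : 'rV_3 => z 0 b); last by apply/funext => z.
  exact: smooth_coord.
rewrite (_ : (fun z => _) = fun z => g z 0 b); last by apply/funext => z.
exact: sg.
Qed.

Lemma smooth_on_differentiable n m (U : set 'rV[R]_n) (g : 'rV[R]_n -> 'rV[R]_m) x :
  smooth_on U g -> U x -> differentiable g x.
Proof. by move=> sg Ux; apply: differentiable_row => a; exact: (sg a [::]). Qed.

Lemma T4_projP (z w : 'rV[R]_4) : T4_proj z = T4_proj w ->
  exists k : 'rV[int]_4, z = w + (pi *+ 2) *: map_mx intr k.
Proof. by move/eqmodP/asboolP. Qed.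

Lemma sub_row_lattice m n (c : R) (z : 'rV[R]_m) (y : 'rV[R]_n) (k : 'rV[int]_n) :
  row_mx z (y + c *: map_mx intr k) - row_mx z y = c *: map_mx intr (row_mx 0 k).
Proof.
rewrite map_row_mx map_mx0 scale_row_mx scaler0 opp_row_mx add_row_mx subrr.
by rewrite addrC addKr.
Qed.

Section Immersion.
Variables (B : set 'rV[R]_3) (f : 'rV[R]_3 -> T4 R) (g : 'rV[R]_3 -> 'rV[R]_4).
Hypotheses (openB : open B) (liftg : smooth_lift (@T4_proj R) B f g).
Let iota := fun x : 'rV[R]_3 => (x, f x).

Lemma BT4_proj_hv_row x : B x -> BT4_proj (hv_row x (g x)) = iota x.
Proof.
move=> Bx; rewrite /BT4_proj /iota -(liftg.2 x Bx).
by congr (_, T4_proj _); [exact: row_mxKl|exact: row_mxKr].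
Qed.

Lemma differential_section_exists x : B x ->
  differential_at (@BT4_proj R) iota x (graph ('J g x)).
Proof.
move=> Bx; have dg := smooth_on_differentiable liftg.1 Bx.
exists (fun z => hv_row z (g z)); split.
- have : \forall z \near x, B z by exact: open_nbhs_nbhs.
  by apply: filterS => z Bz; rewrite BT4_proj_hv_row.
- exact: differentiable_hv_row.
- by rewrite jacobian_hv_row.
Qed.

(** The given lift h and the global lift differ near x by a map with values in the
    lattice 0 x 2 pi Z^4, hence by a constant. *)
Lemma differential_section_unique x J : B x ->
  differential_at (@BT4_proj R) iota x J -> J = graph ('J g x).
Proof.
move=> Bx [h [hlift dh ->]]; have dg := smooth_on_differentiable liftg.1 Bx.
rewrite -(jacobian_hv_row dg).
set s := fun z => hv_row z (g z); have ds : differentiable s x := differentiable_hv_row dg.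
pose e z := h z - s z.
have ce : {for x, continuous e} := differentiable_continuous (differentiableB dh ds).
have elat : \forall z \near x, exists k : 'rV[int]_7, e z = (pi *+ 2) *: map_mx intr k.
  have nB : \forall z \near x, B z by exact: open_nbhs_nbhs.
  near=> z.
  have Bz : B z by near: z.
  have : iota z = BT4_proj (h z) by near: z.
  rewrite -BT4_proj_hv_row // => -[hz /esym/T4_projP[k vz]].
  exists (row_mx 0 k : 'rV_(3 + 4)).
  rewrite /e -[h z](@hsubmxK _ 1 3 4) -/(hpart (h z)) -/(vpart (h z)) -hz vz.
  rewrite /s /hv_row.
  have -> : hpart (row_mx z (g z) : 'rV_7) = z by exact: row_mxKl.
  have -> : vpart (row_mx z (g z) : 'rV_7) = g z by exact: row_mxKr.
  exact: (sub_row_lattice (pi *+ 2) z (g z) k).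
have pi2 : 0 < pi *+ 2 :> R by rewrite mulrn_wgt0 ?pi_gt0.
have ecst := lattice_valued_near_cst pi2 ce elat.
apply: (near_eq_jacobian (w := e x)) => //.
by apply: filterS ecst => z <-; rewrite /e addrC subrK.
Unshelve. all: by end_near.
Qed.

Lemma section_immersion : immersion (@BT4_proj R) B iota.
Proof.
split=> [x Bx|x J Bx /(differential_section_unique Bx) ->]; last exact: graph_row_free.
exists B, (fun z => hv_row z (g z)); split=> //; rewrite setIid.
by split; [exact: smooth_hv_row liftg.1|exact: BT4_proj_hv_row].
Qed.

Lemma calibrated_section_iff :
  adiabatic_calibrated_immersion B iota <->
  forall x, B x -> fueter ('J g x) = 0.
Proof.
split=> [[_ cal] x Bx|fu].
  by apply/calibrated_graph/(cal x) => //; exact: differential_section_exists.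
split=> [|x J Bx /(differential_section_unique Bx) ->]; first exact: section_immersion.
exact/calibrated_graph/fu.
Qed.

End Immersion.

(** * The curvature of the Fourier-Mukai transform *)

Section Curvature.

Lemma ext_complex_intform n l : ext_complex (intform n R l) = intform n R[i] l.
Proof.
apply/ffunP => S; rewrite !ffunE rmorph_sum.
by apply: eq_bigr => t _; rewrite rmorph_int.
Qed.

Lemma im_complexE (r : R) : 0 +i* r = 'i%C * r%:C :> R[i].
Proof. by rewrite /GRing.mul /=; congr (_ +i* _); ring. Qed.

Lemma dc_complex i : dc R[i] i = ext_complex (dc R i).
Proof. by apply/ffunP => S; rewrite !ffunE; case: eqP. Qed.

(** The covectors have real coefficients, so the connection form is purely
    imaginary and differentiates through its imaginary part. *)
Lemma im_combination (c : 'I_4 -> R) :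
  \sum_(a < 4) (0 +i* c a) *: dc R[i] (a + 4) =
  [ffun S : {set 'I_7} => 0 +i* (\sum_(a < 4) c a * dc R (a + 4) S)].
Proof.
apply/ffunP => S; rewrite sum_ffunE [RHS]ffunE im_complexE rmorph_sum mulr_sumr.
apply: eq_bigr => a _.
by rewrite scale_extE dc_complex [ext_complex _ _]ffunE im_complexE rmorphM mulrA.
Qed.

Lemma dc2C (K : comNzRingType) (a b : 'I_4) :
  dc2 K (a + 4) (b + 4) = - dc2 K (b + 4) (a + 4).
Proof.
have lt7 (c : 'I_4) : ((c + 4).-1 < 7)%N by rewrite addn4; exact: (ltn_ord c).
rewrite !dc2_intform // -intform_opp; apply: intform_eq.
by case: a b => [] [|[|[|[|//]]]] ? [] [|[|[|[|//]]]] ?; vm_compute.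
Qed.

(** The coefficients commute while the covectors anticommute. *)
Lemma fm_connection_wedge_self (g : 'rV[R]_3 -> 'rV[R]_4) m :
  wedge (fm_connection g m) (fm_connection g m) = 0.
Proof.
set A := fm_connection g m; pose c a : R[i] := 0 +i* g m.1 0 a.
have AA : wedge A A = \sum_(a < 4) \sum_(b < 4) (c a * c b) *: dc2 R[i] (a + 4) (b + 4).
  rewrite {1}/A {1}/fm_connection wedge_suml; apply: eq_bigr => a _.
  rewrite wedgeZl /A /fm_connection wedge_sumr scaler_sumr; apply: eq_bigr => b _.
  by rewrite wedgeZr scalerA.
have AN : wedge A A = - wedge A A.
  rewrite {1}AA exchange_big AA -sumrN; apply: eq_bigr => a _; rewrite -sumrN.
  by apply: eq_bigr => b _; rewrite dc2C scalerN mulrC.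
apply/ffunP => S; move/ffunP/(_ S): AN; rewrite !ffunE => /eqP.
by rewrite -subr_eq0 opprK -mulr2n mulrn_eq0 /= => /eqP.
Qed.

Lemma hpart_hv_row (x : 'rV[R]_3) (y : 'rV[R]_4) : hpart (hv_row x y) = x.
Proof. exact: row_mxKl. Qed.

(** The two difference quotients are the same function, as hpart is linear. *)
Lemma derive_comp_hpart (G : 'rV[R]_3 -> R^o) (p v : 'rV[R]_7) :
  'D_v (fun q => G (hpart q)) p = 'D_(hpart v) G (hpart p).
Proof.
rewrite /derive; set u := (X in lim (X @ _)); set w := (X in _ = lim (X @ _)).
suff -> : u = w by [].
apply/funext => h; rewrite /u /w /=; congr (_ *: (G _ - _)).
by apply/rowP => i; rewrite /hpart; rewrite !mxE.
Qed.

Lemma derive_combination n m (g : 'rV[R]_n -> 'rV[R]_m) (c : 'I_m -> R) x i :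
  differentiable g x ->
  'D_(delta_mx 0 i) (fun z => \sum_(a < m) g z 0 a * c a : R^o) x =
  \sum_(a < m) 'J g x i a * c a.
Proof.
move=> dg.
have dga a : derivable (fun z => g z 0 a : R^o) x (delta_mx 0 i).
  by have /derivable_mxP := diff_derivable (v := delta_mx 0 i) dg; exact.
rewrite (_ : (fun z => _) = \sum_(a < m) (fun z => c a *: (g z 0 a : R^o))); last first.
  apply/funext => z; rewrite fct_sumE; apply: eq_bigr => a _; exact: mulrC.
rewrite derive_sum => [|a]; last exact: derivableZ.
by apply: eq_bigr => a _; rewrite deriveZ // jacobianE // mulrC.
Qed.

Lemma partial_ext_fm_connection (g : 'rV[R]_3 -> 'rV[R]_4) x (y : 'rV[R]_4) j :
  partial_ext j (fm_connection g \o @BT4dual_proj R) (hv_row x y) =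
  [ffun S : {set 'I_7} => 0 +i* 'D_(hpart (delta_mx 0 j))
     (fun z => \sum_(a < 4) g z 0 a * dc R (a + 4) S : R^o) x].
Proof.
apply/ffunP => S; rewrite !ffunE; congr (_ +i* _).
  rewrite (_ : (fun q => _) = cst 0) ?derive_cst //.
  by apply/funext => q; rewrite /fm_connection /= im_combination ffunE.
rewrite (_ : (fun q => _) = fun q => \sum_(a < 4) g (hpart q) 0 a * dc R (a + 4) S).
  rewrite (derive_comp_hpart (fun z => \sum_(a < 4) g z 0 a * dc R (a + 4) S)).
  by rewrite hpart_hv_row.
by apply/funext => q; rewrite /fm_connection /= im_combination ffunE.
Qed.

Lemma curvature_fm_connection (g : 'rV[R]_3 -> 'rV[R]_4) x y :
  differentiable g x ->
  curvature (fm_connection g) (x, y) =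
    mixed2 (map_mx (fun r => 0 +i* r) ('J g x)).
Proof.
move=> dg; rewrite /curvature fm_connection_wedge_self addr0 /ext_diff.
rewrite [LHS](@big_split_ord _ _ _ 3 4) /= [X in _ + X]big1 ?addr0 => [|j _].
  (* The dx^i part; along the fibre directions the connection is constant. *)
  apply: eq_bigr => i _.
  have -> : covec R[i] (lshift 4 i) = dc R[i] i.+1.
    rewrite /dc; congr covec; apply: val_inj; rewrite /= inordK //.
    exact: leq_trans (ltn_ord i) _.
  rewrite partial_ext_fm_connection.
  have -> : hpart (delta_mx 0 (lshift 4 i) : 'rV[R]_7) = delta_mx 0 i.
    by rewrite delta_mx_lshift; exact: row_mxKl.
  under eq_ffun do rewrite derive_combination //.
  rewrite -im_combination wedge_sumr; apply: eq_bigr => a _.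
  by rewrite wedgeZr [in RHS]mxE.
rewrite partial_ext_fm_connection.
have -> : hpart (delta_mx 0 (rshift 3 j) : 'rV[R]_7) = 0.
  by rewrite delta_mx_rshift; exact: row_mxKl.
rewrite (_ : [ffun S => _] = 0) ?wedge0r //.
by apply/ffunP => S; rewrite !ffunE derive0.
Qed.

Lemma fueter_im_eq0 (M : 'M[R]_(3, 4)) :
  fueter (map_mx (fun r => 0 +i* r) M) = 0 <-> fueter M = 0.
Proof.
have -> : map_mx (fun r => 0 +i* r) M = 'i%C *: map_mx (real_complex R) M.
  by apply/matrixP => i a; rewrite !mxE im_complexE.
rewrite fueterZ map_fueter; split=> [/eqP|->]; last by rewrite map_mx0 scaler0.
by rewrite scaler_eq0 map_mx_eq0 eq_complex /= oner_eq0 andbF => /eqP.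
Qed.

End Curvature.
End Derivatives.

(** * The equivalence *)

Theorem theorem8p4 (R : realType) (B : set 'rV[R]_3)
    (openB : open B) (contrB : contractible B)
    (f : 'rV[R]_3 -> T4 R) (smooth_f : smooth_map (@T4_proj R) B f)
    (lift_f : 'rV[R]_3 -> 'rV[R]_4)
    (lift_fP : smooth_lift (@T4_proj R) B f lift_f) :
  let iota := fun x : 'rV[R]_3 => (x, f x) in
  let F := curvature (fm_connection lift_f) in
  let star_phi := ext_complex (hodge (phi R)) in
  let Theta := ext_complex (Theta_und R) in
  (adiabatic_calibrated_immersion B iota <->
     (forall (x : 'rV[R]_3) (y : T4dual R), B x -> wedge (F (x, y)) star_phi = 0))
  /\
  ((forall (x : 'rV[R]_3) (y : T4dual R), B x -> wedge (F (x, y)) star_phi = 0) <->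
     (forall (x : 'rV[R]_3) (y : T4dual R), B x -> wedge (F (x, y)) Theta = 0)).
Proof.
move=> iota F star_phi Theta.
have FE x y : B x -> F (x, y) = mixed2 (map_mx (fun r => 0 +i* r)%C ('J lift_f x)).
  by move=> Bx; apply: curvature_fm_connection; exact: smooth_on_differentiable lift_fP.1 Bx.
have starE : star_phi = hodge (phi R[i]).
  by rewrite /star_phi !phi_intform !hodge_intform ext_complex_intform.
have ThetaE : Theta = Theta_und R[i] by rewrite /Theta !Theta_intform ext_complex_intform.
have star_Theta x y : B x -> wedge (F (x, y)) star_phi = wedge (F (x, y)) Theta.
  by move=> Bx; rewrite FE // starE ThetaE wedge_mixed2_hodge_phi.
have Theta_fueter x y : B x -> wedge (F (x, y)) Theta = 0 <-> fueter ('J lift_f x) = 0.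
  move=> Bx; rewrite FE // ThetaE.
  exact: iff_trans (wedge_mixed2_Theta_eq0 _) (fueter_im_eq0 _).
split; last by split=> h x y Bx; move: (h x y Bx); rewrite star_Theta.
rewrite (calibrated_section_iff openB lift_fP); split=> [h x y Bx|h x Bx].
  by rewrite star_Theta //; apply/Theta_fueter => //; exact: h.
(* The equation at one point of the fibre is enough, as J depends only on x. *)
by apply/(Theta_fueter x (T4dual_proj 0)) => //; rewrite -star_Theta //; exact: h.
Qed.
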